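(* For any positive integers $m$ and $n$ there exist a reflexive lattice polytope $P$ and indices $i_1<j_1<i_2<j_2<\cdots<i_m<j_m<i_{m+1}$ such that \[ h^*_{i_\ell}-h^*_{j_\ell}\ge n\quad\text{and}\quad h^*_{i_{\ell+1}}-h^*_{j_\ell}\ge n\qquad\text{for }1\le\ell\le m, \] where $h^*(P)=(h^*_0,\ldots,h^*_{\dim P})$. Furthermore, $P$ can be chosen so that $\dim P=O(m\log\log n)$.
   Context: For a lattice $N'$ and a $d$-dimensional lattice polytope $P\subset N'_{\mathbb R}$, $\operatorname{Ehr}_P(t)=1+\sum_{m\ge1}\#(mP\cap N')\,t^m$ and $(1-t)^{d+1}\operatorname{Ehr}_P(t)=h^*_0+\cdots+h^*_dt^d$. $P$ is reflexive if $0$ is in its interior and $P^\circ=\{u\in M'_{\mathbb R}:\langle u,v\rangle\ge-1\ \forall v\in P\}$ has vertices in $M'=\operatorname{Hom}(N',\mathbb Z)$. The dimension bound means there is an absolute constant $C$ such that $P$ can be chosen with $\dim P\le C\,m\log\log n$ (for $n$ large enough that $\log\log n$ is defined and positive). *)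

(* Defs.v *)
From HB Require Import structures.
From mathcomp Require Import all_boot all_order all_algebra.
From mathcomp Require Import Rstruct.
Set Implicit Arguments. Unset Strict Implicit. Unset Printing Implicit Defensive.
Import Order.TTheory GRing.Theory Num.Theory.
Local Open Scope ring_scope.

Section Polytopes.
Variable R : realFieldType.
Variable d : nat.

(* the ambient space N'_R = R^d, with lattice N' = Z^d (and M' = Z^d
   via the standard pairing) *)
Definition pt := 'rV[R]_d.

Definition latt (z : 'rV[int]_d) : pt := map_mx (fun k : int => k%:~R) z.

Definition conv (V : seq pt) (x : pt) : Prop :=
  exists lam : 'I_(size V) -> R,
    (forall i, 0 <= lam i) /\ \sum_i lam i = 1 /\
    x = \sum_i lam i *: V`_i.

Definition lpoly (V : seq 'rV[int]_d) : pt -> Prop := conv (map latt V).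

Definition pairing (u v : pt) : R := \sum_i u 0 i * v 0 i.

Definition zero_interior (P : pt -> Prop) : Prop :=
  exists e : R, 0 < e /\ forall x : pt, (forall i, `|x 0 i| < e) -> P x.

Definition polar (P : pt -> Prop) (u : pt) : Prop :=
  forall v, P v -> -1 <= pairing u v.

Definition reflexive_polytope (V : seq 'rV[int]_d) : Prop :=
  zero_interior (lpoly V) /\
  exists W : seq 'rV[int]_d, forall u, polar (lpoly V) u <-> lpoly W u.

Definition latt_count (V : seq 'rV[int]_d) (m k : nat) : Prop :=
  exists s : seq 'rV[int]_d, uniq s /\ size s = k /\
    forall z, (z \in s) <-> (exists y, lpoly V y /\ latt z = m%:R *: y).

Definition ehrhart_coeffs (V : seq 'rV[int]_d) (L : nat -> nat) : Prop :=
  L 0%N = 1%N /\ forall m, (0 < m)%N -> latt_count V m (L m).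

End Polytopes.

(* h*_k = coefficient of t^k in (1-t)^(d+1) * sum_m L m t^m *)
Definition hstar (d : nat) (L : nat -> nat) (k : nat) : int :=
  \sum_(j < (minn k d.+1).+1) (-1) ^+ j * ('C(d.+1, j) * L (k - j)%N)%:Z.

(* Main.v *)
(* If q_0 = 1, q_1, ..., q_d are positive integers each dividing Q = sum q_i,
   then the simplex with vertices e_1, ..., e_d, -(q_1, ..., q_d) is reflexive
   and, with b_i = Q / q_i, its h*-polynomial is the sum over 0 <= x < Q of
   t^w(x), where w(x) = x - sum_i floor(x / b_i).

   Sylvester's sequence s_j = 2, 3, 7, ... satisfies
   sum_(j < k) 1 / s_j = 1 - 1 / S with S = prod_(j < k) s_j, and S is doubly
   exponential in k.  Splitting the missing 1 / S as sum_i 1 / (S c_i), for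
   sum_i 1 / c_i = 1, multiplies the two h*-polynomials.  Take for c the
   denominators of Payne's weights, whose h*-polynomial is
   (1 + t + ... + t^(3k+2)) (1 + t^a + ... + t^((m+1)a)) with a = 2k + 2:
   from degree a on, its coefficients are alternately 2 and 1 on windows of k + 1
   consecutive degrees.  The Sylvester factor has degree at most k and coefficient sum S, so
   in the product the last degree of each window has coefficient 2S or S. *)
Require Import Defs.
From Stdlib Require Import Reals Lra.
From HB Require Import structures.
From mathcomp Require Import all_boot all_order all_algebra.
From mathcomp Require Import Rstruct.
From mathcomp Require Import zify ring lra.

Set Implicit Arguments. Unset Strict Implicit. Unset Printing Implicit Defensive.

(** * Ehrhart series of simplices *)

Section EhrhartSeries.
Import GRing.Theory.
Local Open Scope ring_scope.

(** Compares coefficients of t^n in (1 - t)^(d+1) * (1 - t)^-(d+1) = 1. The induction moves one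
    factor 1 - t from the polynomial to the series, with Pascal's rule on each side. *)
Lemma alternating_bin_conv d n :
  \sum_(0 <= j < n.+1) (-1) ^+ j * ('C(d.+1, j) * 'C(d + (n - j), d))%:Z
    = (n == 0%N)%:Z.
Proof.
elim: d n => [|d IHd] n.
  case: n => [|n]; first by rewrite big_nat1.
  rewrite !big_nat_recl // big1 /= ?bin0 ?bin1 // => i _.
  by rewrite bin_small ?mul0n ?mulr0.
case: n => [|n]; first by rewrite big_nat1 /= !bin0 subnn addn0 binn.
pose F j : int := (-1) ^+ j * ('C(d.+1, j) * 'C(d.+1 + (n.+1 - j), d.+1))%:Z.
pose G j : int := (-1) ^+ j * ('C(d.+1, j) * 'C(d.+1 + (n - j), d.+1))%:Z.
transitivity (\sum_(0 <= j < n.+2) F j - \sum_(0 <= j < n.+1) G j).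
  rewrite !(big_nat_recl n.+1) // {1}/F /= !bin0 -addrA -sumrB; congr (_ + _).
  apply: eq_bigr => j _; rewrite /F /G binS subSS exprS mulnDl PoszD; ring.
rewrite big_nat_recr //= addrAC -sumrB -(IHd n.+1) [RHS]big_nat_recr //=.
congr (_ + _); last by rewrite /F subnn !addn0 !binn.
apply: eq_big_nat => j /andP[_ jn]; rewrite /F /G -mulrBr; congr (_ * _).
by rewrite subSn // !addSn !addnS binS !PoszM PoszD; ring.
Qed.

Lemma hstar_widen d (L : nat -> nat) k :
  hstar d L k = \sum_(0 <= j < k.+1) (-1) ^+ j * ('C(d.+1, j) * L (k - j)%N)%:Z.
Proof.
rewrite /hstar -(big_mkord xpredT
  (fun j => (-1) ^+ j * ('C(d.+1, j) * L (k - j)%N)%:Z)).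
rewrite [RHS](@big_cat_nat _ _ _ (minn k d.+1).+1) ?ltnS ?geq_minl //=.
rewrite [X in _ + X]big_nat_cond [X in _ + X]big1 ?addr0 // => j.
rewrite andbT => /andP[lt_j le_j]; rewrite bin_small ?mul0n ?mulr0 //.
by lia.
Qed.

(** A box at height [w x] contributes the series t^(w x) / (1 - t)^(d+1), so multiplying by (1 -
    t)^(d+1) leaves t^(w x). *)
Lemma hstar_boxes d Q (w : nat -> nat) k :
  hstar d (fun m => \sum_(0 <= x < Q | w x <= m) 'C(d + (m - w x), d))%N k
    = Posz (\sum_(0 <= x < Q) (w x == k))%N.
Proof.
rewrite hstar_widen.
transitivity (\sum_(0 <= x < Q) \sum_(0 <= j < k.+1)
  (if (w x <= k - j)%N then
    (-1) ^+ j * ('C(d.+1, j) * 'C(d + (k - j - w x), d))%:Z else 0)).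
  rewrite exchange_big; apply: eq_bigr => j _.
  rewrite -big_mkcond /= -mulr_sumr; congr (_ * _).
  by rewrite big_distrr /= (big_morph Posz PoszD (erefl 0%:Z)).
rewrite (big_morph Posz PoszD (erefl 0%:Z)); apply: eq_bigr => x _.
have [le_wk | lt_kw] := leqP (w x) k; last first.
  rewrite big1_seq ?(gtn_eqF lt_kw) // => j _.
  by rewrite ifF //; lia.
rewrite (@big_cat_nat _ _ _ (k - w x).+1) //=; last by rewrite ltnS leq_subr.
rewrite [X in _ + X]big_nat_cond [X in _ + X]big1 ?addr0; last first.
  by move=> j; rewrite andbT => Hj; rewrite ifF //; lia.
transitivity ((k - w x == 0)%N%:Z); last by congr (Posz _); lia.
rewrite -(alternating_bin_conv d); apply: eq_big_nat => j Hj.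
by rewrite ifT ?(subnAC k j); [|lia].
Qed.

End EhrhartSeries.

(** * Reflexive simplices from unit fractions, and the lattice points of their dilates *)

Section Simplex.
Import Order.TTheory GRing.Theory Num.Theory.
Local Open Scope ring_scope.

Lemma lpoly_simplex (R : realFieldType) d (v0 : 'rV[int]_d)
    (v : 'I_d -> 'rV[int]_d) (x : 'rV[R]_d) :
  lpoly (v0 :: map v (enum 'I_d)) x <->
  exists (l0 : R) (lam : 'I_d -> R),
    [/\ 0 <= l0, forall i, 0 <= lam i, l0 + \sum_i lam i = 1 &
      forall j, x 0 j = l0 * (v0 0 j)%:~R + \sum_i lam i * (v i 0 j)%:~R].
Proof.
rewrite /lpoly /conv; set V := map _ _.
have nthV (i : 'I_d) : V`_(lift ord0 i) = latt R (v i).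
  have id_lt : (i < size (enum 'I_d))%N by rewrite size_enum_ord.
  by rewrite lift0 /= -map_comp (nth_map i _ _ id_lt) nth_ord_enum.
have sizeV : size V = d.+1 by rewrite size_map /= size_map size_enum_ord.
have V0 : V`_0 = latt R v0 by [].
clearbody V; rewrite sizeV; split=> [[lam [lam0 [lam1 ->]]]|].
  exists (lam ord0), (fun i => lam (lift ord0 i)).
  split=> //; first by rewrite -lam1 big_ord_recl.
  move=> j; rewrite big_ord_recl V0 !mxE summxE; congr (_ + _).
  by apply: eq_bigr => i _; rewrite nthV !mxE.
move=> [l0 [lam [l0_ge0 lam_ge0 lam1 xE]]].
exists (fun i => if unlift ord0 i is Some j then lam j else l0).
split=> [i|]; first by case: unliftP.
split; rewrite big_ord_recl unlift_none.
  by rewrite -lam1; congr (_ + _); apply: eq_bigr => i _; rewrite liftK.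
apply/rowP => j; rewrite xE V0 !mxE summxE; congr (_ + _).
by apply: eq_bigr => i _; rewrite liftK nthV !mxE.
Qed.

Variables (d : nat) (b : 'I_d -> nat) (Q : nat).
Hypothesis b_dvd : forall i, (b i %| Q)%N.
Hypothesis egyptianQ : ((\sum_i Q %/ b i).+1 = Q)%N.

Let q i := (Q %/ b i)%N.

Definition weight_vertices : seq 'rV[int]_d :=
  \row_j (- (q j)%:Z) :: [seq delta_mx 0 i | i <- enum 'I_d].

(** Vertices of the polar simplex: the first is the normal of the facet opposite -q, the others
    those of the facets opposite the e_i. They are integral because each q_i divides Q. *)
Definition weight_normals : seq 'rV[int]_d :=
  const_mx (-1) ::
    [seq \row_j ((if i == j then b i else 0%N)%:Z - 1) | i <- enum 'I_d].

Let Q_gt0 : (0 < Q)%N. Proof. by rewrite -egyptianQ. Qed.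
Let b_gt0 i : (0 < b i)%N. Proof. exact: dvdn_gt0 (b_dvd i). Qed.
Let qb i : (q i * b i = Q)%N. Proof. exact: divnK. Qed.

Section Facets.
Variable R : realFieldType.

Let QR : (Q%:R : R) = 1 + \sum_i (q i)%:R.
Proof. by rewrite -egyptianQ -natr_sum -add1n natrD. Qed.
Let QR_gt0 : 0 < Q%:R :> R. Proof. by rewrite ltr0n. Qed.
Let bR_gt0 i : 0 < (b i)%:R :> R. Proof. by rewrite ltr0n. Qed.
Let qbR i : (q i)%:R * (b i)%:R = Q%:R :> R. Proof. by rewrite -natrM qb. Qed.

Let sum_delta (c : 'I_d -> R) j :
  \sum_i c i * ((delta_mx 0 i : 'rV[int]_d) 0 j)%:~R = c j.
Proof.
rewrite (bigD1 j) //= big1 ?addr0; first by rewrite mxE !eqxx mulr1.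
by move=> i ij; rewrite mxE eq_sym (negPf ij) andbF mulr0.
Qed.

(** If l_0 and l_i are the barycentric coordinates at -q and e_i, the two facet expressions are Q *
    l_0 and b_i * l_i. *)
Lemma weight_vertices_facets (x : 'rV[R]_d) :
  lpoly weight_vertices x <->
  0 <= 1 - \sum_i x 0 i /\
  forall i, 0 <= (b i)%:R * x 0 i + (1 - \sum_i x 0 i).
Proof.
rewrite lpoly_simplex; split.
  move=> [l0 [lam [l0_ge0 lam_ge0 lam1 xE]]].
  have {}xE j : x 0 j = lam j - l0 * (q j)%:R.
    by rewrite xE mxE sum_delta mulrNz mulrN addrC.
  have -> : 1 - \sum_i x 0 i = l0 * Q%:R.
    under eq_bigr do rewrite xE.
    by rewrite sumrB -mulr_sumr -[X in X - _]lam1 QR; ring.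
  split=> [|i]; first by rewrite mulr_ge0 // ler0n.
  rewrite xE -(qbR i) (_ : _ + _ = (b i)%:R * lam i); last by ring.
  by rewrite mulr_ge0 ?ler0n.
move=> [x_sum x_b]; pose l0 := (1 - \sum_i x 0 i) / Q%:R.
have l0Q : 1 - \sum_i x 0 i = Q%:R * l0.
  by rewrite mulrC divfK // lt0r_neq0.
exists l0, (fun i => x 0 i + (q i)%:R * l0); split.
- by rewrite divr_ge0 // ler0n.
- move=> i; rewrite -(pmulr_rge0 _ (bR_gt0 i)); move: (x_b i).
  by rewrite l0Q -(qbR i); congr (_ <= _); ring.
- transitivity (\sum_i x 0 i + Q%:R * l0); last by rewrite -l0Q; ring.
  by rewrite big_split /= -mulr_suml QR; ring.
by move=> j; rewrite mxE sum_delta mulrNz; ring.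
Qed.

(** The inequalities say that u pairs to at least -1 with every e_i and with -q, so they cut out the
    polar of the first simplex. *)
Lemma weight_normals_facets (u : 'rV[R]_d) :
  lpoly weight_normals u <->
  (forall i, -1 <= u 0 i) /\ \sum_i (q i)%:R * u 0 i <= 1.
Proof.
have sum_normals (c : 'I_d -> R) j : \sum_i c i *
     ((\row_k ((if i == k then b i else 0%N)%:Z - 1) : 'rV_d) 0 j)%:~R
   = c j * (b j)%:R - \sum_i c i.
  under eq_bigr do rewrite mxE intrB mulrBr mulr1.
  rewrite sumrB; congr (_ - _); rewrite (bigD1 j) //= eqxx big1 ?addr0 //.
  by move=> i /negPf ->; rewrite mulr0.
rewrite lpoly_simplex; split.
  move=> [l0 [lam [l0_ge0 lam_ge0 lam1 uE]]].
  have {}uE j : u 0 j = lam j * (b j)%:R - 1.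
    by rewrite uE sum_normals mxE -[X in _ = _ - X]lam1; ring.
  split=> [i|]; first by rewrite uE lerBDl subrr mulr_ge0 ?ler0n.
  have -> : \sum_i (q i)%:R * u 0 i = 1 - Q%:R * l0.
    under eq_bigr do rewrite uE mulrBr mulr1 mulrCA qbR.
    rewrite sumrB -mulr_suml (_ : \sum_i lam i = 1 - l0) ?QR; first by ring.
    by rewrite -lam1; ring.
  by rewrite gerBl mulr_ge0 // ler0n.
move=> [u_ge u_q]; pose lam i := (u 0 i + 1) / (b i)%:R.
have lamE i : lam i = ((q i)%:R * u 0 i + (q i)%:R) / Q%:R.
  rewrite /lam -(qbR i); field; rewrite !lt0r_neq0 //.
  by rewrite -(pmulr_lgt0 _ (bR_gt0 i)) qbR.
pose l0 : R := (1 - \sum_i (q i)%:R * u 0 i) / Q%:R.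
have lam1 : l0 + \sum_i lam i = 1.
  rewrite (eq_bigr _ (fun i _ => lamE i)) -mulr_suml big_split /= -mulrDl QR.
  by rewrite addrA subrK divff // -QR lt0r_neq0.
exists l0, lam; split=> //.
- by rewrite divr_ge0 ?subr_ge0 ?ler0n.
- by move=> i; rewrite divr_ge0 ?ler0n // -lerBlDr sub0r.
move=> j; rewrite mxE sum_normals divfK ?lt0r_neq0 //.
rewrite (_ : \sum_i lam i = 1 - l0); [ring | rewrite -lam1; ring].
Qed.

Lemma weight_vertices_reflexive : reflexive_polytope R weight_vertices.
Proof.
split.
  (* In the cube of radius 1 / (Q + d), the coordinates sum to at most d / (Q + d), and b_i * x_i >=
     -Q / (Q + d) since b_i <= Q; hence all facet expressions stay nonnegative. *)
  exists (Q + d)%:R^-1; split=> [|x x_lt]; first by rewrite invr_gt0 ltr0n; lia.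
  set e := _^-1 in x_lt; have eQd : Q%:R * e + d%:R * e = 1.
    by rewrite -mulrDl -natrD divff // pnatr_eq0; lia.
  have e_gt0 : 0 < e by rewrite invr_gt0 ltr0n; lia.
  have x_sum : \sum_i x 0 i <= d%:R * e.
    apply: (@le_trans _ _ (\sum_(i < d) e)).
      by apply: ler_sum => i _; have := x_lt i; rewrite ltr_norml; lra.
    by rewrite sumr_const card_ord mulr_natl.
  have Qe : 0 <= Q%:R * e by rewrite mulr_ge0 ?ler0n // ltW.
  apply/weight_vertices_facets; split=> [|i]; first by lra.
  have : (b i)%:R * - e <= (b i)%:R * x 0 i.
    by rewrite ler_pM2l //; have := x_lt i; rewrite ltr_norml; lra.
  have : (b i)%:R * e <= Q%:R * e by rewrite ler_pM2r // ler_nat dvdn_leq.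
  by rewrite mulrN; lra.
exists weight_normals => u; rewrite weight_normals_facets; split.
  move=> u_polar; split=> [j|].
    have /u_polar : lpoly weight_vertices (delta_mx 0 j : 'rV[R]_d).
      apply/weight_vertices_facets.
      rewrite (bigD1 j) //= big1 => [|i /negPf ij]; last by rewrite mxE ij andbF.
      rewrite mxE !eqxx addr0 subrr; split=> // i.
      by rewrite mxE addr0 mulr_ge0 ?ler0n.
    rewrite /pairing (bigD1 j) //= big1 => [|i /negPf ij].
      by rewrite mxE !eqxx mulr1 addr0.
    by rewrite mxE ij andbF mulr0.
  have /u_polar : lpoly weight_vertices (\row_j - (q j)%:R : 'rV[R]_d).
    apply/weight_vertices_facets; under eq_bigr do rewrite mxE.
    rewrite sumrN opprK -QR; split=> [|i]; first by rewrite ler0n.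
    by rewrite mxE mulrN mulrC qbR addNr.
  rewrite /pairing; under eq_bigr do rewrite mxE mulrN mulrC.
  by rewrite sumrN lerN2.
move=> [u_ge u_q] x; rewrite lpoly_simplex => -[l0 [lam [l0_ge0 lam_ge0 lam1 xE]]].
have {}xE j : x 0 j = lam j - l0 * (q j)%:R.
  by rewrite xE mxE sum_delta mulrNz mulrN addrC.
have -> : pairing u x = \sum_i lam i * u 0 i - l0 * \sum_i (q i)%:R * u 0 i.
  by rewrite mulr_sumr -sumrB; apply: eq_bigr => i _; rewrite xE; ring.
have : - \sum_i lam i <= \sum_i lam i * u 0 i.
  rewrite -sumrN; apply: ler_sum => i _.
  by rewrite -mulrN1 ler_wpM2l.
have : l0 * \sum_i (q i)%:R * u 0 i <= l0 by rewrite ler_piMr.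
by move: lam1; lra.
Qed.

(** Scaling the facet inequalities by m makes them integral, so counting lattice points no longer
    involves [R]. *)
Lemma weight_vertices_dilate (m : nat) (z : 'rV[int]_d) : (0 < m)%N ->
  (exists y : 'rV[R]_d, lpoly weight_vertices y /\ latt R z = m%:R *: y) <->
  0 <= m%:Z - \sum_i z 0 i /\
  forall i, 0 <= (b i)%:Z * z 0 i + (m%:Z - \sum_i z 0 i).
Proof.
move=> m_gt0; have mR : 0 < m%:R :> R by rewrite ltr0n.
have scale (y : 'rV[R]_d) : latt R z = m%:R *: y ->
   (m%:Z - \sum_i z 0 i)%:~R = m%:R * (1 - \sum_i y 0 i) /\
   forall i, ((b i)%:Z * z 0 i + (m%:Z - \sum_i z 0 i))%:~R
     = m%:R * ((b i)%:R * y 0 i + (1 - \sum_i y 0 i)).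
  move=> zE; have {}zE i : (z 0 i)%:~R = m%:R * y 0 i.
    by have /rowP/(_ i) := zE; rewrite !mxE.
  have sumE : (m%:Z - \sum_i z 0 i)%:~R = m%:R * (1 - \sum_i y 0 i) :> R.
    rewrite intrB mulrBr mulr1 rmorph_sum /= mulr_sumr; congr (_ - _).
    by apply: eq_bigr => i _; rewrite zE.
  by split=> // i; rewrite intrD intrM sumE zE /=; ring.
split=> [[y [/weight_vertices_facets[y_sum y_b] /scale[zs zb]]] | [z_sum z_b]].
  by split=> [|i]; rewrite -(ler0z R) ?zs ?zb mulr_ge0 ?ler0n.
exists (m%:R^-1 *: latt R z).
have zE : latt R z = m%:R *: (m%:R^-1 *: latt R z).
  by rewrite scalerA divff ?scale1r // lt0r_neq0.
split=> //; have [zs zb] := scale _ zE; apply/weight_vertices_facets.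
split=> [|i]; rewrite -(pmulr_rge0 _ mR) -?zs -?zb ler0z //; exact: z_b.
Qed.

End Facets.

(** Sums Q * floor(x / b_i) <= q_i * x, using sum_i q_i = Q - 1. Hence the subtraction in
    [weight_age] never truncates, and its result is 0 only at x = 0. *)
Let sum_divn_le x : (Q * (\sum_i x %/ b i) <= Q.-1 * x)%N.
Proof.
rewrite -[X in X.-1]egyptianQ big_distrr big_distrl /=; apply: leq_sum => i _.
by rewrite -/(q i) -{1}(qb i) -mulnA leq_mul2l mulnC leq_divM orbT.
Qed.

Let weight_age x := (x - \sum_i x %/ b i)%N.

Let weight_ageK x : (weight_age x + \sum_i x %/ b i = x)%N.
Proof. by rewrite subnK // -(leq_pmul2l Q_gt0); have := sum_divn_le x; nia. Qed.

Let weight_age_eq0 x : (weight_age x == 0)%N = (x == 0)%N.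
Proof.
apply/eqP/eqP => [age0 | ->]; last by rewrite /weight_age sub0n.
by have := sum_divn_le x; have := weight_ageK x; rewrite age0; nia.
Qed.

(** Stars and bars: for each x, the binomial counts the ways to write m - [weight_age x] as an
    ordered sum of d + 1 naturals. *)
Definition weight_ehrhart m : nat :=
  (\sum_(0 <= x < Q | weight_age x <= m) 'C(d + (m - weight_age x), d))%N.

Lemma weight_ehrhart0 : weight_ehrhart 0 = 1%N.
Proof.
rewrite /weight_ehrhart (big_ltn_cond Q_gt0) /weight_age sub0n leqnn subnn.
rewrite addn0 binn big_nat_cond big1 // => x /andP[/andP[x0 _]].
by rewrite leqn0 weight_age_eq0 gtn_eqF.
Qed.

(* For a lattice point z of m P, [y = m - sum_i z_i] is Q times the barycentric
   weight of the vertex -q.  Writing [y = x + Q * t_0] with [x < Q] and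
   [z_i = t_i - floor (y / b_i)], the facet inequalities become [t_i >= 0], and
   the [t_i] sum to [m - weight_age x]. *)
Let box_point x (n : nat) (t : (d.+1).-tuple 'I_n.+1) : 'rV[int]_d :=
  \row_i ((tnth t (lift ord0 i) : nat)%:Z
            - ((x + Q * tnth t ord0) %/ b i)%N%:Z).

Let sum_tupleE n (t : (d.+1).-tuple 'I_n.+1) :
  (\sum_(i <- t) i = tnth t ord0 + \sum_(i < d) tnth t (lift ord0 i))%N.
Proof. by rewrite big_tuple big_ord_recl. Qed.

Let divn_shift x c i : ((x + Q * c) %/ b i = x %/ b i + q i * c)%N.
Proof. by rewrite -{1}(qb i) mulnAC divnDMl. Qed.

(** The floors of x / b_i restore [weight_age x] to x, and sum_i q_i = Q - 1 turns the terms in t_0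
    into Q * t_0. Division by Q then recovers x and t_0 from the point, which gives injectivity. *)
Let box_point_height m x (t : (d.+1).-tuple 'I_(m - weight_age x).+1) :
  (weight_age x <= m)%N -> (\sum_(i <- t) i = m - weight_age x)%N ->
  m%:Z - \sum_i box_point x t 0 i = (x + Q * tnth t ord0)%N%:Z.
Proof.
rewrite sum_tupleE => le_m sum_t.
under eq_bigr do rewrite mxE.
rewrite sumrB -!(big_morph Posz PoszD (erefl 0%:Z)).
under [X in _ - (_ - Posz X)]eq_bigr do rewrite divn_shift.
rewrite big_split -big_distrl /=; move: sum_t le_m (weight_ageK x).
have : ((\sum_i q i).+1 = Q)%N := egyptianQ.
move: (\sum_i q i)%N (\sum_i x %/ b i)%N => s B.
set A := (X in (_ + X)%N = _ -> _); set a := weight_age x.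
rewrite -[X in m%:Z - (Posz X - _)]/A; move: A => A <- sum_t le_m <-; rewrite mulSn.
by lia.
Qed.

Lemma weight_lattice_points m : exists s : seq 'rV[int]_d,
  uniq s /\ size s = weight_ehrhart m /\
  forall z, z \in s <->
    0 <= m%:Z - \sum_i z 0 i /\
    forall i, 0 <= (b i)%:Z * z 0 i + (m%:Z - \sum_i z 0 i).
Proof.
pose bases := [seq x <- iota 0 Q | weight_age x <= m]%N.
pose parts x := enum [set t : (d.+1).-tuple 'I_(m - weight_age x).+1
                       | \sum_(i <- t) i == m - weight_age x]%N.
have mem_bases x : x \in bases = (x < Q)%N && (weight_age x <= m)%N.
  by rewrite mem_filter mem_iota /= andbC.
have mem_parts x t : (t \in parts x) = (\sum_(i <- t) i == m - weight_age x)%N.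
  by rewrite mem_enum inE.
exists [seq box_point x t | x <- bases, t <- parts x]; split; last split.
- apply: allpairs_uniq_dep => [|x _|].
  - exact/filter_uniq/iota_uniq.
  - exact: enum_uniq.
  move=> _ _ /allpairsPdep[x [t [xb tp ->]]] /allpairsPdep[x' [t' [xb' tp' ->]]] /=.
  move: xb tp xb' tp'; rewrite !mem_bases !mem_parts.
  move=> /andP[ltxQ le_m] /eqP st /andP[ltxQ' le_m'] /eqP st' eq_pt.
  have := box_point_height le_m st; rewrite eq_pt box_point_height // => /eqP.
  rewrite eqz_nat => /eqP eq_y.
  have eq_x : x = x'.
    have modQ y c : (y + Q * c = y %[mod Q])%N by rewrite mulnC addnC modnMDl.
    by have := congr1 (modn^~ Q) eq_y; rewrite !modQ !modn_small.
  subst x'; congr existT; apply: eq_from_tnth => i; apply: val_inj => /=.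
  have [j ->|->] := unliftP ord0 i; last by move: eq_y; nia.
  have /rowP/(_ j) := eq_pt; rewrite !mxE eq_y => /addIr.
  by case.
- rewrite size_allpairs_dep sumnE big_map big_filter.
  rewrite /weight_ehrhart /index_iota subn0; apply: eq_bigr => x _.
  by rewrite -cardE card_ord_partitions.
move=> z; split=> [/allpairsPdep[x [t [xb tp ->]]] | [z_sum z_b]].
  move: xb tp; rewrite mem_bases mem_parts => /andP[ltxQ le_m] /eqP st.
  rewrite box_point_height //; split=> // i; rewrite mxE.
  move: (x + _)%N => y; rewrite mulrBr -addrA addr_ge0 //.
  by rewrite addrC subr_ge0 -PoszM lez_nat mulnC leq_divM.
have [y yE] : exists y : nat, m%:Z - \sum_i z 0 i = y%:Z.
  by exists (absz (m%:Z - \sum_i z 0 i)%R); lia.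
rewrite yE in z_b.
(* As z_i is an integer, z_i >= -y / b_i gives z_i >= -floor(y / b_i), so t_i = z_i + floor(y / b_i)
   is a natural number. *)
have [c cE] : exists c : 'I_d -> nat, forall i, z 0 i = (c i)%:Z - (y %/ b i)%N%:Z.
  exists (fun i => absz (z 0 i + (y %/ b i)%N%:Z)%R) => i.
  have := z_b i; have := b_gt0 i; have := divn_eq y (b i); have := ltn_pmod y (b_gt0 i).
  by nia.
pose x := (y %% Q)%N.
have yx : (x + Q * (y %/ Q) = y)%N by rewrite mulnC addnC -divn_eq.
have c_sum : (y %/ Q + \sum_i c i + weight_age x = m)%N.
  have : \sum_i z 0 i = (\sum_i c i)%:Z - (\sum_i y %/ b i)%N%:Z.
    rewrite !(big_morph Posz PoszD (erefl 0%:Z)) -sumrB.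
    by apply: eq_bigr => i _; rewrite cE.
  have -> : (\sum_i y %/ b i = \sum_i x %/ b i + (\sum_i q i) * (y %/ Q))%N.
    rewrite big_distrl -big_split /=; apply: eq_bigr => i _.
    by rewrite -divn_shift yx.
  move: yx (weight_ageK x) yE; have : ((\sum_i q i).+1 = Q)%N := egyptianQ.
  move: (\sum_i q i)%N (\sum_i x %/ b i)%N (\sum_i c i)%N (\sum_i z 0 i).
  move: (weight_age x) => a; clearbody x; move: (y %/ Q)%N => y0 s B A Z <- <- <-.
  by rewrite mulSn; lia.
have parts_sum : (m - weight_age x = y %/ Q + \sum_i c i)%N.
  by rewrite -c_sum addnK.
(* Each part is at most the total, hence fits the bounded type of the tuple entries. *)
have c_lt i : (c i < (m - weight_age x).+1)%N.
  by rewrite ltnS parts_sum (bigD1 i) //= addnCA leq_addr.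
have t0_lt : (y %/ Q < (m - weight_age x).+1)%N by rewrite ltnS parts_sum leq_addr.
pose t : (d.+1).-tuple 'I_(m - weight_age x).+1 :=
  [tuple if unlift ord0 i is Some j then Ordinal (c_lt j) else Ordinal t0_lt
  | i < d.+1].
have t0E : tnth t ord0 = Ordinal t0_lt by rewrite tnth_mktuple unlift_none.
have tE j : tnth t (lift ord0 j) = Ordinal (c_lt j) by rewrite tnth_mktuple liftK.
apply/allpairsPdep; exists x, t; rewrite mem_bases mem_parts ltn_pmod //.
rewrite sum_tupleE t0E; under eq_bigr do rewrite tE; split=> /=.
- by rewrite -c_sum leq_addl.
- by rewrite parts_sum.
by apply/rowP => i; rewrite mxE tE t0E /= yx cE.
Qed.

End Simplex.

(** * Sylvester weights *)

Lemma sum_nat_mul a b (F : nat -> nat) :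
  \sum_(0 <= x < a * b) F x
    = \sum_(0 <= k < a) \sum_(0 <= r < b) F (k + a * r).
Proof.
rewrite mulnC big_nat_mul exchange_big; apply: eq_bigr => i _.
rewrite -{1}[i * a]add0n big_addn mulSnr addKn.
by apply: eq_bigr => k _; rewrite (mulnC i).
Qed.

Lemma leq_sum_range a b (F G : nat -> nat) :
  (forall i, a <= i < b -> F i <= G i) ->
  \sum_(a <= i < b) F i <= \sum_(a <= i < b) G i.
Proof.
move=> leFG; rewrite big_nat_cond [leqRHS]big_nat_cond.
by apply: leq_sum => i; rewrite andbT => /leFG.
Qed.

Lemma sum_nat_eq_indicator a n i :
  \sum_(0 <= y < n) (a + y == i) = (a <= i < a + n).
Proof.
elim: n => [|n IHn]; first by rewrite big_nil; lia.
by rewrite big_nat_recr //= IHn; lia.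
Qed.

(* [(sylvester j).+1] is Sylvester's sequence 2, 3, 7, 43, ... and
   [sylvester k] is the product of its first [k] terms. *)
Fixpoint sylvester k :=
  if k is k'.+1 then sylvester k' * (sylvester k').+1 else 1.

Lemma sylvester_gt0 k : 0 < sylvester k.
Proof. by elim: k => //= k IHk; rewrite muln_gt0 IHk. Qed.

Lemma dvdn_sylvester j k : j < k -> (sylvester j).+1 %| sylvester k.
Proof.
elim: k => // k IHk; rewrite ltnS leq_eqVlt => /predU1P[-> | /IHk] /=.
  exact: dvdn_mull.
exact: dvdn_mulr.
Qed.

(** With S = [sylvester k], the inductive step is (S + 1) * (S - 1) + S + 1 = S * (S + 1). *)
Lemma sylvester_egyptian k :
  (\sum_(0 <= j < k) sylvester k %/ (sylvester j).+1).+1 = sylvester k.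
Proof.
elim: k => [|k IHk]; first by rewrite big_nil.
rewrite big_nat_recr //= mulnK //.
transitivity ((\sum_(0 <= j < k) (sylvester k %/ (sylvester j).+1)
                 * (sylvester k).+1 + sylvester k).+1).
  congr (_ + _).+1; apply: eq_big_nat => j /= /dvdn_sylvester.
  by move=> jk; rewrite divn_mulAC.
by rewrite -big_distrl /=; move: IHk; set s := \sum_(_ <= _ < _) _; nia.
Qed.

Definition sylvester_age k x := x - \sum_(0 <= j < k) x %/ (sylvester j).+1.

Lemma sylvester_age_sum k x :
  sylvester_age k x + \sum_(0 <= j < k) x %/ (sylvester j).+1 = x.
Proof.
rewrite /sylvester_age subnK //.
have S0 := sylvester_gt0 k.
rewrite -(leq_pmul2l S0) big_distrr /=.
apply: (@leq_trans (x * \sum_(0 <= j < k) sylvester k %/ (sylvester j).+1)).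
  rewrite big_distrr /= leq_sum_range // => j /= /dvdn_sylvester /divnK {1}<-.
  by rewrite -mulnA mulnC leq_mul2r [_.+1 * _]mulnC leq_divM orbT.
rewrite mulnC leq_mul2r -[X in _ <= X](sylvester_egyptian k).
by rewrite leqnSn orbT.
Qed.

(** Since floor(x / s) >= (x + 1) / s - 1, the floors sum to at least (x + 1) * (1 - 1 / S) - k. The
    age is therefore at most k - 1 + (x + 1) / S, and x + 1 <= S. *)
Lemma sylvester_age_le k x : x < sylvester k -> sylvester_age k x <= k.
Proof.
move=> ltxS; have ageE := sylvester_age_sum k x.
have := sylvester_egyptian k; set S := sylvester k in ltxS * => egS.
pose q j := S %/ (sylvester j).+1.
have: \sum_(0 <= j < k) q j * x.+1
        <= \sum_(0 <= j < k) (S * (x %/ (sylvester j).+1) + S).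
  rewrite leq_sum_range // => j /= /dvdn_sylvester /divnK.
  rewrite -/S -/(q j) => Sj.
  rewrite -Sj addnC -mulnS -mulnA leq_mul2l; apply/orP; right.
  by rewrite mulnC; apply: ltn_ceil.
rewrite big_split /= sum_nat_const_nat subn0 -big_distrl -big_distrr /=.
move: egS; rewrite -/q; set A := \sum_(_ <= _ < _) q _.
move: ageE; set B := \sum_(_ <= _ < _) (x %/ _).
set a := sylvester_age k x; clearbody S A B a => ageE egS le_sum.
rewrite leqNgt; apply/negP => ltka.
by have := leq_mul (leqnn S) ltka; nia.
Qed.

(** Each product is at least the square of the preceding one, starting from [sylvester 1] = 2. *)
Lemma sylvester_ge k : 2 ^ (2 ^ k) <= sylvester k.+1.
Proof.
elim: k => // k IHk; rewrite expnS mul2n -addnn expnD [sylvester _]/=.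
by apply: leq_mul => //; apply: leqW.
Qed.

Lemma divn_mixed_radix a b u y z : u < a -> y < b ->
  (u + a * (y + b * z)) %/ (a * b) = z.
Proof.
move=> ltua ltyb; rewrite divnMA (_ : u + _ = (y + b * z) * a + u); last lia.
rewrite divnMDl ?(divn_small ltua) ?addn0; last lia.
by rewrite (_ : y + _ = z * b + y) ?divnMDl ?(divn_small ltyb) ?addn0 //; lia.
Qed.

(** * Combining Sylvester's and Payne's weights *)

Section Weights.
Variables k m : nat.

Let S := sylvester k.
Let K := 3 * k.+1.
Let T := m.+2 * K.

(** With one more copy of S * T, the reciprocals of the three blocks sum to 2 / (3S), 1 / (3S) and 1
    - 1 / S, hence to 1 in all. The [.-1] removes that copy, which stands for q_0 = 1. *)
Definition denominators : seq nat :=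
  nseq (m.+2 * (2 * k.+1)).-1 (S * T) ++ nseq k.+1 (S * K)
    ++ [seq (sylvester j).+1 | j <- iota 0 k].

Let S_gt0 : 0 < S. Proof. exact: sylvester_gt0. Qed.

Lemma size_denominators : size denominators = m.+2 * (2 * k.+1) + 2 * k.
Proof. by rewrite !size_cat !size_nseq size_map size_iota; nia. Qed.

Lemma sum_denominators (F : nat -> nat) :
  \sum_(b <- denominators) F b =
    (m.+2 * (2 * k.+1)).-1 * F (S * T) + k.+1 * F (S * K)
      + \sum_(0 <= j < k) F (sylvester j).+1.
Proof.
have sum_nseq n b : \sum_(i <- nseq n b) F i = n * F b.
  by rewrite big_nseq iter_addn_0 mulnC.
rewrite !big_cat !sum_nseq big_map /index_iota subn0; exact: addnA.
Qed.

Lemma denominators_dvdn : all (dvdn^~ (S * T)) denominators.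
Proof.
rewrite !all_cat !all_nseq dvdnn orbT dvdn_pmul2l // dvdn_mull //= ?orbT.
apply/allP => b /mapP[j]; rewrite mem_iota => /andP[_ ltjk] ->.
by rewrite dvdn_mulr // dvdn_sylvester.
Qed.

Lemma denominators_egyptian :
  (\sum_(b <- denominators) (S * T) %/ b).+1 = S * T.
Proof.
rewrite sum_denominators divnn divnMl // {2}/T mulnK // muln_gt0 S_gt0 /=.
have -> : \sum_(0 <= j < k) S * T %/ (sylvester j).+1
        = \sum_(0 <= j < k) S %/ (sylvester j).+1 * T.
  by apply: eq_big_nat => j /= /dvdn_sylvester jS; rewrite divn_mulAC.
rewrite -big_distrl /=; have := sylvester_egyptian k; rewrite -/S.
by set s := \sum_(_ <= _ < _) _; rewrite /T /K; nia.
Qed.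

(** The first block's floors vanish, the second's add up to (k + 1) * z, and the Sylvester block
    splits because each s_j divides S. The step in z is thus K - (k + 1) = 2 * (k + 1). Additivity
    in u, y and z is the factorisation of the h*-polynomial. *)
Lemma denominators_age u y z : u < S -> y < K -> z < m.+2 ->
  let x := u + S * (y + K * z) in
  x - \sum_(b <- denominators) x %/ b
    = sylvester_age k u + y + 2 * k.+1 * z.
Proof.
move=> ltuS ltyK ltz x.
have xT : x < S * T.
  have : y + K * z < T by rewrite /T; nia.
  by rewrite /x; nia.
rewrite sum_denominators (divn_small xT) muln0 add0n.
have -> : x %/ (S * K) = z.
  exact: divn_mixed_radix.
have -> : \sum_(0 <= j < k) x %/ (sylvester j).+1
    = \sum_(0 <= j < k) u %/ (sylvester j).+1
       + (\sum_(0 <= j < k) S %/ (sylvester j).+1) * (y + K * z).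
  rewrite big_distrl -big_split /=; apply: eq_big_nat => j /= /dvdn_sylvester jS.
  by rewrite /x divnDr ?dvdn_mulr // -divn_mulAC.
have := sylvester_egyptian k; rewrite -/S.
have := sylvester_age_sum k u.
set A := \sum_(_ <= _ < _) _ => Au; set B := \sum_(_ <= _ < _) _ => BS.
by rewrite /x -[in S * _]BS mulSn /K; lia.
Qed.

Definition age x := x - \sum_(b <- denominators) x %/ b.

Lemma age_count i :
  \sum_(0 <= x < S * T) (age x == i)
    = \sum_(0 <= u < S) \sum_(0 <= z < m.+2)
        (sylvester_age k u + 2 * k.+1 * z <= i
           < sylvester_age k u + 2 * k.+1 * z + K).
Proof.
rewrite sum_nat_mul; apply: eq_big_nat => u /= ltuS.
rewrite /T mulnC sum_nat_mul exchange_big.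
apply: eq_big_nat => z /= ltz.
rewrite -sum_nat_eq_indicator; apply: eq_big_nat => y /= ltyK.
by rewrite /age denominators_age // addnAC.
Qed.

(** The intervals indexed by z have length 3 * (k + 1) and step 2 * (k + 1). For every shift a <= k,
    this degree lies in exactly those with z = l - 1 and z = l, both in range by the bounds on l. *)
Lemma age_count_peak l : 1 <= l <= m.+1 ->
  \sum_(0 <= x < S * T) (age x == 2 * k.+1 * l + k) = 2 * S.
Proof.
move=> /andP[l1 lm]; rewrite age_count.
transitivity (\sum_(0 <= u < S) 2); last by rewrite sum_nat_const_nat; lia.
apply: eq_big_nat => u /= /sylvester_age_le; move: (sylvester_age k u) => a le_ak.
transitivity (\sum_(0 <= z < m.+2) ((0 + z == l.-1) + (0 + z == l))).
  apply: eq_big_nat => z _; rewrite /K.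
  case: l l1 {lm} => // l _ /=.
  have [lt_zl | lt_lz | ->] := ltngtP z l; first 1 last.
  - have [-> | ?] := eqVneq z l.+1; first by lia.
    have : 2 * k.+1 * l.+2 <= 2 * k.+1 * z by rewrite leq_mul2l; lia.
    by lia.
  - by lia.
  have : 2 * k.+1 * z.+1 <= 2 * k.+1 * l by rewrite leq_mul2l; lia.
  by lia.
by rewrite big_split /= !sum_nat_eq_indicator; lia.
Qed.

(** For every shift a <= k, the interval of l - 1 has already ended and that of l + 1 begins no
    earlier than the next degree, so only z = l counts. *)
Lemma age_count_valley l : l <= m.+1 ->
  \sum_(0 <= x < S * T) (age x == 2 * k.+1 * l + (2 * k).+1) = S.
Proof.
move=> lm; rewrite age_count.
transitivity (\sum_(0 <= u < S) 1); last by rewrite sum_nat_const_nat; lia.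
apply: eq_big_nat => u /= /sylvester_age_le; move: (sylvester_age k u) => a le_ak.
transitivity (\sum_(0 <= z < m.+2) (0 + z == l)).
  apply: eq_big_nat => z _; rewrite /K.
  have [lt_zl | lt_lz | ->] := ltngtP z l; last by lia.
    have : 2 * k.+1 * z.+1 <= 2 * k.+1 * l by rewrite leq_mul2l; lia.
    by lia.
  have : 2 * k.+1 * l.+1 <= 2 * k.+1 * z by rewrite leq_mul2l; lia.
  by lia.
by rewrite sum_nat_eq_indicator; lia.
Qed.

End Weights.

(** * Doubly exponential growth against log log n *)

Section IteratedLog.
Local Open Scope R_scope.

Lemma ln_le x y : 0 < x -> x <= y -> ln x <= ln y.
Proof. by move=> x0 [/(ln_increasing _ _ x0)/Rlt_le | ->] //; apply: Rle_refl. Qed.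

Lemma lnln3_gt0 : 0 < ln (ln 3).
Proof.
have e_lt3 : exp 1 < 3.
  (* Six is the least N with (1 - 1 / N)^N > 1 / 3, which yields 1 / e > 1 / 3. *)
  have e6 : 5 / 6 < exp (- / 6).
    have : 1 + - / 6 < exp (- / 6) by apply: exp_ineq1; Lra.lra.
    Lra.lra.
  have : (5 / 6) ^ 6 <= exp (- / 6) ^ 6 by apply: pow_incr; Lra.lra.
  have -> : exp (- / 6) ^ 6 = / exp 1.
    by rewrite -exp_Ropp /= !Rmult_1_r -!exp_plus; congr exp; Lra.lra.
  move=> e1; have e0 := exp_pos 1.
  apply: Rnot_le_lt => le3; have : / exp 1 <= / 3 by apply: Rinv_le_contravar; Lra.lra.
  Lra.lra.
have : ln (exp 1) < ln 3 by apply: ln_increasing => //; apply: exp_pos.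
rewrite ln_exp => ln3.
by rewrite -ln_1; apply: ln_increasing; Lra.lra.
Qed.

Lemma lnln_gt0 n : 0 < ln (ln (INR n)) -> (2 < n)%N.
Proof.
move=> lnln; rewrite ltnNge; apply/negP => le2.
have ln2_lt1 : ln 2 < 1.
  rewrite -(ln_exp 1); apply: ln_increasing; first by Lra.lra.
  have := exp_ineq1 1; Lra.lra.
have ln_le1 : ln (INR n) <= 1.
  case: n le2 {lnln} => [|[|[|//]]] _ /=.
  (* For n = 0 this is the default value of [ln], which is 0 at nonpositive arguments. *)
  - by rewrite /ln; case: Rlt_dec => [/Rlt_irrefl|_] //; apply: Rle_0_1.
  - rewrite ln_1; Lra.lra.
  - exact: Rlt_le ln2_lt1.
have [ln_gt0 | ln_le0] := Rlt_le_dec 0 (ln (INR n)).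
  have := ln_le ln_gt0 ln_le1; rewrite ln_1; Lra.lra.
move: lnln; rewrite {1}/ln; case: Rlt_dec => [/(Rle_not_lt _ _ ln_le0) //|_].
exact: Rlt_irrefl.
Qed.

(** Takes logarithms twice. One factor 2 in 2^k is spent against ln 2 > 1 / 2, which costs the
    additive 1; the same bound gives the factor 2. *)
Lemma lnln_gt k n : (2 ^ (2 ^ k) <= n)%N -> 0 < ln (ln (INR n)) ->
  INR k <= 1 + 2 * ln (ln (INR n)).
Proof.
case: k => [|k] le_n lnln; first by rewrite /=; Lra.lra.
have ln2 := ln_lt_2.
have INR_exp a b : INR (a ^ b) = INR a ^ b.
  by elim: b => //= b IHb; rewrite expnS mult_INR IHb.
have INR2 : INR 2 = 2 by [].
have pow_gt0 : 0 < 2 ^ k by apply: pow_lt; Lra.lra.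
have ln_ge : 2 ^ k.+1 * ln 2 <= ln (INR n).
  rewrite -INR2 -INR_exp -ln_pow; last by rewrite INR2; Lra.lra.
  apply: ln_le; first by apply: pow_lt; rewrite INR2; Lra.lra.
  by rewrite -INR_exp; apply: le_INR; apply/leP.
have {}ln_ge : 2 ^ k <= ln (INR n) by move: ln_ge => /=; Lra.nra.
have := ln_le pow_gt0 ln_ge; rewrite ln_pow; last by Lra.lra.
by rewrite S_INR; have := pos_INR k; Lra.nra.
Qed.

Lemma sylvester_loglog : exists C : R, forall n, exists k,
  [/\ (0 < k)%N, (n <= sylvester k)%N
    & 0 < ln (ln (INR n)) -> INR k <= C * ln (ln (INR n))].
Proof.
(* The minimal k satisfies k <= 3 + 2 * ln ln n. As ln ln n >= ln ln 3 > 0 for n >= 3, the constant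
   3 is absorbed into the multiple 3 / ln ln 3. *)
exists (3 / ln (ln 3) + 2) => n.
have exk : exists k, (0 < k)%N && (n <= sylvester k)%N.
  exists n.+1; apply: leq_trans (sylvester_ge n).
  by apply/ltnW/(@ltn_trans (2 ^ n)); apply: ltn_expl.
case: (ex_minnP exk) => k /andP[k_gt0 le_nk] k_min.
exists k; split=> // lnln; have n3 := lnln_gt0 lnln.
have k_le : INR k <= 3 + 2 * ln (ln (INR n)).
  (* For k >= 2, minimality gives 2^(2^(k-2)) <= [sylvester k.-1] < n. *)
  case: k k_gt0 k_min {le_nk} => [//|[|k]] _ k_min; first by rewrite /=; Lra.lra.
  have : (2 ^ (2 ^ k) <= n)%N.
    apply: leq_trans (sylvester_ge k) _; rewrite leqNgt; apply/negP => lt_n.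
    by have := k_min k.+1 (ltnW lt_n); rewrite ltnn.
  by move=> /lnln_gt/(_ lnln); rewrite !S_INR; Lra.lra.
have L0 := lnln3_gt0.
have le_lnln : ln (ln 3) <= ln (ln (INR n)).
  have ln3 : 0 < ln 3 by rewrite -ln_1; apply: ln_increasing; Lra.lra.
  apply: ln_le => //; apply: ln_le; first by Lra.lra.
  have -> : 3 = INR 3 by rewrite /=; Lra.lra.
  by apply: le_INR; apply/leP.
have : 3 <= 3 / ln (ln 3) * ln (ln (INR n)).
  have -> : 3 / ln (ln 3) * ln (ln (INR n)) = 3 * (ln (ln (INR n)) / ln (ln 3)).
    by rewrite /Rdiv !Rmult_assoc [Rmult (Rinv _) _]Rmult_comm.
  have : 1 <= ln (ln (INR n)) / ln (ln 3)
    by apply: (Rmult_le_reg_r _ _ _ L0); rewrite Rmult_1_l Rmult_assoc Rinv_l;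
      Lra.lra.
  Lra.lra.
Lra.lra.
Qed.

End IteratedLog.

Theorem theorem1p6 :
  exists C : R,
  forall m n : nat, (0 < m)%N -> (0 < n)%N ->
  exists (d : nat) (V : seq 'rV[int]_d) (L : nat -> nat) (i j : nat -> nat),
    reflexive_polytope R V /\
    ehrhart_coeffs R V L /\
    (forall l, (1 <= l <= m)%N -> (i l < j l < i l.+1)%N) /\
    (i m.+1 <= d)%N /\
    (forall l, (1 <= l <= m)%N ->
        (Posz n <= hstar d L (i l) - hstar d L (j l))%R /\
        (Posz n <= hstar d L (i l.+1) - hstar d L (j l))%R) /\
    (Rlt 0 (ln (ln (INR n))) ->
       Rle (INR d) (Rmult (Rmult C (INR m)) (ln (ln (INR n))))).
Proof.
have [C Csylv] := sylvester_loglog; exists (Rmult 14 C) => m n m_gt0 n_gt0.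
have [k [k_gt0 le_nS le_kC]] := Csylv n.
pose ds := denominators k m; pose Q := sylvester k * (m.+2 * (3 * k.+1)).
pose b (i : 'I_(size ds)) := nth 0 ds i.
have sum_b F : \sum_i F (b i) = \sum_(c <- ds) F c.
  by rewrite (big_nth 0) big_mkord.
have b_dvd i : b i %| Q by apply: (all_nthP 0 (denominators_dvdn k m)).
have egyptianQ : (\sum_i Q %/ b i).+1 = Q.
  by rewrite (sum_b (fun c => Q %/ c)) denominators_egyptian.
have hstarE i : hstar (size ds) (weight_ehrhart b Q) i
    = Posz (\sum_(0 <= x < Q) (age k m x == i)).
  rewrite hstar_boxes; congr Posz; apply: eq_bigr => x _.
  by rewrite (sum_b (fun c => x %/ c)).
have sizeE : size ds = m.+2 * (2 * k.+1) + 2 * k := size_denominators k m.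
exists (size ds), (weight_vertices b Q), (weight_ehrhart b Q).
(* i_l ends a window of k + 1 degrees where two intervals overlap, and j_l = i_l + k + 1 ends the
   following window, covered once. The coefficients there are 2S and S, with S >= n. *)
exists (fun l => 2 * k.+1 * l + k), (fun l => 2 * k.+1 * l + (2 * k).+1).
split; first exact: weight_vertices_reflexive.
split.
  split=> [|l l_gt0]; first exact: (weight_ehrhart0 b_dvd egyptianQ).
  have [s [s_uniq [s_size s_mem]]] := weight_lattice_points b_dvd egyptianQ l.
  exists s; split=> //; split=> // z.
  by rewrite s_mem weight_vertices_dilate.
split; first by move=> l _; lia.
split; first by rewrite sizeE; nia.
split.
  move=> l /andP[l_gt0 le_lm].
  rewrite !hstarE age_count_valley ?age_count_peak; lia.
move=> /le_kC{}le_kC; rewrite sizeE.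
(* From m + 2 <= 3m and k + 1 <= 2k, the dimension is at most 12mk + 2k <= 14mk; this is the source
   of the factor 14. *)
have le_d : m.+2 * (2 * k.+1) + 2 * k <= 14 * m * k by nia.
have : Rle (INR (m.+2 * (2 * k.+1) + 2 * k)) (INR (14 * m * k)).
  by apply: le_INR; apply/leP.
move=> /Rle_trans; apply; rewrite !mult_INR.
have -> : INR 14 = IZR 14 by exact: INR_IZR_INZ.
have m14_ge0 : Rle 0 (Rmult 14 (INR m)).
  by apply: Rmult_le_pos (pos_INR m); Lra.lra.
by have := Rmult_le_compat_l _ _ _ m14_ge0 le_kC; Lra.lra.
Qed.
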